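(* Let $\lambda\geq 1$, $\mu\geq 0$, $\delta\geq 0$ and $0\leq\alpha<1$ be real numbers, let $\xi=\frac{2\lambda+\mu}{2\lambda+1}$, and let $f(z)=z+\sum_{m=2}^{\infty}a_m z^m$ be a function in the class $\mathfrak{B}_{\Sigma}^{\mu}(\alpha,\lambda,\delta)$. Let $n\geq 4$ be an integer. If $a_k=0$ for all $2\leq k\leq n-1$, then $$|a_n|\leq\frac{2(1-\alpha)}{\mu+(n-1)\lambda+n(n-1)\xi\delta}.$$
   Context: Let $\mathbb{U}=\{z\in\mathbb{C}:|z|<1\}$ and let $\mathcal{A}$ be the class of analytic functions $f$ on $\mathbb{U}$ with $f(0)=0$, $f'(0)=1$, so $f(z)=z+\sum_{m=2}^{\infty}a_m z^m$. A function $f\in\mathcal{A}$ is bi-univalent if $f$ is univalent in $\mathbb{U}$ and its inverse $f^{-1}$ (defined near $0$) is also univalent in $\mathbb{U}$, i.e. $f^{-1}$ extends to a univalent analytic function $g$ on $\mathbb{U}$. $\Sigma$ denotes the class of bi-univalent functions. For $\lambda\geq1$, $\mu\geq0$, $\delta\geq0$, $0\leq\alpha<1$ and $\xi=\frac{2\lambda+\mu}{2\lambda+1}$, a function $f\in\Sigma$ belongs to $\mathfrak{B}_{\Sigma}^{\mu}(\alpha,\lambda,\delta)$ if, with $g=f^{-1}$, for all $z,w\in\mathbb{U}$: $$\operatorname{Re}\left((1-\lambda)\left(\frac{f(z)}{z}\right)^{\mu}+\lambda f'(z)\left(\frac{f(z)}{z}\right)^{\mu-1}+\xi\delta z f''(z)\right)>\alpha,$$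 $$\operatorname{Re}\left((1-\lambda)\left(\frac{g(w)}{w}\right)^{\mu}+\lambda g'(w)\left(\frac{g(w)}{w}\right)^{\mu-1}+\xi\delta w g''(w)\right)>\alpha.$$ Here $f(z)/z$ and $g(w)/w$ are the nonvanishing analytic functions on $\mathbb{U}$ taking value $1$ at $0$, and their powers are the analytic branches taking value $1$ at $0$. *)

(* Defs.v *)
From Stdlib Require Export Reals.
From Coquelicot Require Export Coquelicot.

Open Scope R_scope.

Definition in_U (z : C) : Prop := Cmod z < 1.

(* Complex differentiability: the scalar field is [C_AbsRing], not [R]. *)
Definition analytic_U (h : C -> C) : Prop :=
  forall z : C, in_U z -> @ex_derive C_AbsRing C_NormedModule h z.

Definition univalent_U (h : C -> C) : Prop :=
  analytic_U h /\
  forall z1 z2 : C, in_U z1 -> in_U z2 -> h z1 = h z2 -> z1 = z2.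

Definition class_A (f : C -> C) : Prop :=
  analytic_U f /\ f 0%C = 0%C /\ C_derive f 0%C = 1%C.

(* [g] agrees near 0 with the inverse of [f] restricted to the unit disc. *)
Definition extends_inverse (f g : C -> C) : Prop :=
  exists r : R, 0 < r /\
    forall w : C, Cmod w < r -> in_U (g w) /\ f (g w) = w.

(* [g] is the analytic continuation of [f^{-1}] to the disc; by the identity
   theorem its values on the disc are determined by [f]. *)
Definition bi_univalent_with (f g : C -> C) : Prop :=
  class_A f /\ univalent_U f /\ univalent_U g /\ extends_inverse f g.

Definition Sigma (f : C -> C) : Prop :=
  exists g : C -> C, bi_univalent_with f g.

Definition Cexp (z : C) : C :=
  (exp (Re z) * cos (Im z), exp (Re z) * sin (Im z)).

(* [h(z)/z] with its removable singularity filled in, for [h] normalized by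
   [h(0) = 0] and [h'(0) = 1]. *)
Definition quot (h : C -> C) (z : C) : C :=
  if Ceq_dec z 0%C then 1%C else (h z / z)%C.

(* [P] is, on the disc, the analytic branch of [q^s] with [P(0) = 1]:
   [q^s = exp (s log q)], where [log q] is the analytic logarithm of [q]
   vanishing at 0 (unique on the disc). *)
Definition power_branch (q : C -> C) (s : R) (P : C -> C) : Prop :=
  exists L : C -> C,
    analytic_U L /\ L 0%C = 0%C /\
    (forall z : C, in_U z -> Cexp (L z) = q z) /\
    (forall z : C, in_U z -> P z = Cexp (RtoC s * L z)%C).

Definition xi (lambda mu : R) : R := (2 * lambda + mu) / (2 * lambda + 1).

Definition Re_condition (mu alpha lambda delta : R) (h : C -> C) : Prop :=
  exists P Q : C -> C,
    power_branch (quot h) mu P /\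
    power_branch (quot h) (mu - 1) Q /\
    forall z : C, in_U z ->
      Re (RtoC (1 - lambda) * P z
          + RtoC lambda * C_derive h z * Q z
          + RtoC (xi lambda mu * delta) * z * C_derive (C_derive h) z)%C
      > alpha.

Definition class_B (mu alpha lambda delta : R) (f : C -> C) : Prop :=
  exists g : C -> C,
    bi_univalent_with f g /\
    Re_condition mu alpha lambda delta f /\
    Re_condition mu alpha lambda delta g.

Lemma class_B_Sigma (mu alpha lambda delta : R) (f : C -> C) :
  class_B mu alpha lambda delta f -> Sigma f.
Proof. intros [g [H _]]; now exists g. Qed.

Definition power_series_on_U (a : nat -> C) (f : C -> C) : Prop :=
  forall z : C, in_U z -> @is_pseries C_AbsRing C_NormedModule a z (f z).

(* Main.v *)
(* Only the condition on f is used. Its functional F satisfies F(z) = 1 + c z^m + o(z^m)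
   at 0, with m = n - 1 and c = (mu + (n-1) lambda + n (n-1) xi delta) a_n, and
   Re F > alpha, so the claim is Caratheodory's bound |c| <= 2 (1 - alpha). Let w be
   unimodular with w c = |c|. For s0 < 0 the function
     K(zeta) = (F(e^zeta) - 1) (1 - (w e^(-m(zeta-s0)) + conj(w) e^(m(zeta-s0))) / 2)
   is 2 i pi-periodic and C^1 in the complex sense on the left half-plane, so by the
   Cauchy-Riemann equations the integral of Re K(s + it) over 0 <= t <= 2 pi does not
   depend on s < 0. It tends to - pi |c| e^(m s0) as s -> -oo. At s = s0 the second
   factor is real and nonnegative with mean 1, so the integral is at least
   -2 pi (1 - alpha). Finally s0 -> 0. *)
Require Import Defs.
From Stdlib Require Import Reals Lra Lia Psatz.
From Coquelicot Require Import Coquelicot.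

Open Scope R_scope.

(** * Complex derivatives and the exponential *)


(* [is_derive_mult] and [is_derive_comp] require the target [AbsRing_NormedModule C_AbsRing],
   which is not convertible to [C_NormedModule]. *)
Definition Cderiv (h : C -> C) (z d : C) : Prop :=
  @is_derive C_AbsRing (AbsRing_NormedModule C_AbsRing) h z d.

Definition Ccont (h : C -> C) (z : C) : Prop :=
  @continuous (AbsRing_UniformSpace C_AbsRing) (AbsRing_UniformSpace C_AbsRing) h z.

Lemma Cderiv_eps (h : C -> C) (z d : C) :
  Cderiv h z d <->
  forall eps : R, 0 < eps -> exists r : R, 0 < r /\
    forall w : C, Cmod (w - z) < r ->
      Cmod (h w - h z - d * (w - z)) <= eps * Cmod (w - z).
Proof.
split.
- intros [_ H] eps Heps.
  destruct (H z (fun P HP => HP) (mkposreal eps Heps)) as [r Hr].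
  exists r; split; [apply cond_pos|]; intros w Hw.
  specialize (Hr w Hw).
  replace (h w - h z - d * (w - z))%C
    with (h w - h z - (w - z) * d)%C by ring.
  exact Hr.
- intros H; split; [apply is_linear_scal_l|].
  (* Differentiability quantifies over every limit [x] of the neighbourhood filter of [z];
     uniqueness of limits leaves only [x = z]. *)
  intros x Hx.
  apply (@is_filter_lim_locally_unique C_AbsRing (AbsRing_NormedModule C_AbsRing)) in Hx.
  subst x.
  intros eps; destruct (H eps (cond_pos eps)) as [r [Hr0 Hr]].
  exists (mkposreal r Hr0); intros w Hw.
  specialize (Hr w Hw).
  replace (h w - h z - d * (w - z))%C
    with (h w - h z - (w - z) * d)%C in Hr by ring.
  exact Hr.
Qed.

(** The error estimates for the two module structures are convertible; only the linearity component
    has to be proved again. *)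
Lemma Cderiv_iff (h : C -> C) (z d : C) :
  @is_derive C_AbsRing C_NormedModule h z d <-> Cderiv h z d.
Proof.
split; intros [_ H]; split; try apply is_linear_scal_l; exact H.
Qed.

Lemma C_derive_Cderiv (h : C -> C) (z d : C) : Cderiv h z d -> C_derive h z = d.
Proof. intros H; apply is_C_derive_unique, Cderiv_iff, H. Qed.

Lemma Ccont_eps (h : C -> C) (z : C) :
  Ccont h z <->
  forall eps : R, 0 < eps -> exists r : R, 0 < r /\
    forall w : C, Cmod (w - z) < r -> Cmod (h w - h z) < eps.
Proof.
split.
- intros H eps Heps.
  destruct (H _ (ex_intro _ (mkposreal eps Heps) (fun y Hy => Hy))) as [r Hr].
  exists r; split; [apply cond_pos|]; exact Hr.
- intros H P [eps HP]; destruct (H eps (cond_pos eps)) as [r [Hr0 Hr]].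
  exists (mkposreal r Hr0); intros w Hw; apply HP, Hr, Hw.
Qed.

Lemma Cderiv_cont (h : C -> C) (z d : C) : Cderiv h z d -> Ccont h z.
Proof.
intros H; apply (@ex_derive_continuous C_AbsRing (AbsRing_NormedModule C_AbsRing)).
exists d; exact H.
Qed.

(** Continuity of the derivative is carried along instead of being drawn from Goursat's theorem. It
    is what differentiation under the integral and the fundamental theorem of calculus ask for in
    [RInt_vertical_const]. *)
Definition C1_on (D : C -> Prop) (h : C -> C) : Prop :=
  exists h' : C -> C, forall z, D z -> Cderiv h z (h' z) /\ Ccont h' z.

Lemma C1_on_cont (D : C -> Prop) h z : C1_on D h -> D z -> Ccont h z.
Proof. intros [h' H] Hz; destruct (H z Hz) as [H1 _]; eapply Cderiv_cont, H1. Qed.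

Lemma Ccont_const (c z : C) : Ccont (fun _ => c) z.
Proof. exact (@continuous_const (AbsRing_UniformSpace C_AbsRing)
  (AbsRing_UniformSpace C_AbsRing) c z). Qed.

Lemma Cderiv_const (c z : C) : Cderiv (fun _ => c) z 0.
Proof. exact (@is_derive_const C_AbsRing (AbsRing_NormedModule C_AbsRing) c z). Qed.

Lemma Cderiv_id (z : C) : Cderiv (fun x => x) z 1.
Proof. exact (@is_derive_id C_AbsRing z). Qed.

Lemma C1_on_const (D : C -> Prop) (c : C) : C1_on D (fun _ => c).
Proof.
exists (fun _ => 0%C); intros z _; split.
- apply Cderiv_const.
- apply Ccont_const.
Qed.

Lemma C1_on_id (D : C -> Prop) : C1_on D (fun z => z).
Proof.
exists (fun _ => 1%C); intros z _; split.
- apply Cderiv_id.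
- apply Ccont_const.
Qed.

Lemma Ccont_plus h k z : Ccont h z -> Ccont k z -> Ccont (fun x => h x + k x)%C z.
Proof. 
exact (@continuous_plus (AbsRing_UniformSpace C_AbsRing) C_AbsRing
  (AbsRing_NormedModule C_AbsRing) h k z).
 Qed.

Lemma Ccont_mult h k z : Ccont h z -> Ccont k z -> Ccont (fun x => h x * k x)%C z.
Proof. exact (@continuous_mult (AbsRing_UniformSpace C_AbsRing) C_AbsRing h k z). Qed.

Lemma Ccont_comp h k z : Ccont k z -> Ccont h (k z) -> Ccont (fun x => h (k x)) z.
Proof.
exact (@continuous_comp (AbsRing_UniformSpace C_AbsRing)
  (AbsRing_UniformSpace C_AbsRing) (AbsRing_UniformSpace C_AbsRing) k h z).
Qed.

Lemma Cderiv_plus h k z dh dk :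
  Cderiv h z dh -> Cderiv k z dk -> Cderiv (fun x => h x + k x)%C z (dh + dk)%C.
Proof. exact (@is_derive_plus C_AbsRing (AbsRing_NormedModule C_AbsRing) h k z dh dk). Qed.

Lemma Cderiv_mult h k z dh dk :
  Cderiv h z dh -> Cderiv k z dk ->
  Cderiv (fun x => h x * k x)%C z (dh * k z + h z * dk)%C.
Proof.
intros H1 H2; exact (@is_derive_mult C_AbsRing h k z dh dk H1 H2 Cmult_comm).
Qed.

Lemma Cderiv_comp h k z dh dk :
  Cderiv h (k z) dh -> Cderiv k z dk -> Cderiv (fun x => h (k x)) z (dk * dh)%C.
Proof.
exact (@is_derive_comp C_AbsRing (AbsRing_NormedModule C_AbsRing) h k z dh dk).
Qed.

Lemma C1_on_plus D h k : C1_on D h -> C1_on D k -> C1_on D (fun z => h z + k z)%C.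
Proof.
intros [h' Hh] [k' Hk]; exists (fun z => h' z + k' z)%C; intros z Hz.
destruct (Hh z Hz), (Hk z Hz); split.
- now apply Cderiv_plus.
- now apply Ccont_plus.
Qed.

Lemma C1_on_mult D h k : C1_on D h -> C1_on D k -> C1_on D (fun z => h z * k z)%C.
Proof.
intros [h' Hh] [k' Hk]; exists (fun z => h' z * k z + h z * k' z)%C; intros z Hz.
destruct (Hh z Hz) as [H1 H2], (Hk z Hz) as [H3 H4]; split.
- now apply Cderiv_mult.
- apply Ccont_plus; apply Ccont_mult; try assumption.
  + eapply Cderiv_cont, H3.
  + eapply Cderiv_cont, H1.
Qed.

Lemma C1_on_comp (D E : C -> Prop) h k :
  C1_on E h -> C1_on D k -> (forall z, D z -> E (k z)) -> C1_on D (fun z => h (k z)).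
Proof.
intros [h' Hh] [k' Hk] HDE; exists (fun z => k' z * h' (k z))%C; intros z Hz.
destruct (Hk z Hz) as [H1 H2], (Hh (k z) (HDE z Hz)) as [H3 H4]; split.
- now apply Cderiv_comp.
- apply Ccont_mult; [exact H2|].
  apply Ccont_comp; [|exact H4].
  eapply Cderiv_cont, H1.
Qed.

Lemma Cexp_add (z w : C) : Cexp (z + w) = (Cexp z * Cexp w)%C.
Proof.
destruct z as [x y], w as [u v]; unfold Cexp; simpl.
rewrite exp_plus, cos_plus, sin_plus.
apply injective_projections; simpl; ring.
Qed.

Lemma Cexp_0 : Cexp 0 = 1%C.
Proof.
unfold Cexp; simpl; rewrite exp_0, cos_0, sin_0.
apply injective_projections; simpl; ring.
Qed.

Lemma Cmod_Cexp (z : C) : Cmod (Cexp z) = exp (Re z).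
Proof.
unfold Cexp, Cmod; simpl.
replace (_ + _) with (exp (Re z) * exp (Re z) * (Rsqr (sin (Im z)) + Rsqr (cos (Im z))))
  by (unfold Rsqr; ring).
rewrite sin2_cos2, Rmult_1_r; apply sqrt_square, Rlt_le, exp_pos.
Qed.

Lemma Cexp_neq_0 (z : C) : Cexp z <> 0%C.
Proof.
apply Cmod_gt_0; rewrite Cmod_Cexp; apply exp_pos.
Qed.

Lemma Cexp_pow (z : C) (n : nat) : Cexp (RtoC (INR n) * z) = (Cexp z ^ n)%C.
Proof.
induction n as [|n IH].
- simpl; rewrite Cmult_0_l; apply Cexp_0.
- rewrite S_INR, RtoC_plus, Cmult_plus_distr_r, Cmult_1_l, Cexp_add, IH, Cpow_S.
  apply Cmult_comm.
Qed.

Lemma Cmod_le_Rabs (z : C) : Cmod z <= Rabs (Re z) + Rabs (Im z).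
Proof.
destruct z as [x y]; simpl.
replace (x, y) with (RtoC x + RtoC y * Ci)%C
  by (apply injective_projections; simpl; ring).
eapply Rle_trans; [apply Cmod_triangle|].
rewrite Cmod_mult, Cmod_Ci, !Cmod_R; lra.
Qed.

Lemma im_le_Cmod (z : C) : Rabs (Im z) <= Cmod z.
Proof.
eapply Rle_trans; [|apply Rmax_Cmod]; apply Rmax_r.
Qed.

Lemma derive_pt_0_eps (h : R -> R) (d : R) :
  is_derive h 0 d -> forall eps : R, 0 < eps -> exists r : R, 0 < r /\
    forall x : R, Rabs x < r -> Rabs (h x - h 0 - d * x) <= eps * Rabs x.
Proof.
intros H eps Heps; apply is_derive_Reals in H.
destruct (H eps Heps) as [r Hr].
exists r; split; [apply cond_pos|]; intros x Hx.
destruct (Req_dec x 0) as [->|Hx0].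
- replace (h 0 - h 0 - d * 0) with 0 by ring; rewrite Rabs_R0; lra.
- specialize (Hr x Hx0 Hx); rewrite Rplus_0_l in Hr.
  replace (h x - h 0 - d * x) with (((h x - h 0) / x - d) * x) by (field; exact Hx0).
  rewrite Rabs_mult; apply Rmult_le_compat_r; [apply Rabs_pos|lra].
Qed.

Lemma Cderiv_Cexp_0 : Cderiv Cexp 0 1.
Proof.
apply Cderiv_eps; intros eps Heps.
(* The real and imaginary errors below are each at most 3 e |w|, so their sum is at most 6 e |w| <=
   eps |w|. The bound [e <= 1] gives |e^x - 1| <= 2 |x|. *)
set (e := Rmin 1 (eps / 8)).
assert (He : 0 < e) by (unfold e; apply Rmin_glb_lt; lra).
assert (He1 : e <= 1) by apply Rmin_l.
assert (He2 : e <= eps / 8) by apply Rmin_r.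
destruct (derive_pt_0_eps exp 1) with (eps := e) as [r1 [Hr1 H1]]; [|exact He|].
{ rewrite <- exp_0; apply is_derive_exp. }
destruct (derive_pt_0_eps cos 0) with (eps := e) as [r2 [Hr2 H2]]; [|exact He|].
{ auto_derive; [exact I|rewrite sin_0; ring]. }
destruct (derive_pt_0_eps sin 1) with (eps := e) as [r3 [Hr3 H3]]; [|exact He|].
{ auto_derive; [exact I|rewrite cos_0; ring]. }
(* The radius [e / 2] turns 2 |x| into at most [e], which controls the cross term (e^x - 1) y and
   gives e^x <= 2. *)
exists (Rmin (Rmin r1 r2) (Rmin r3 (e / 2))); split.
{ repeat apply Rmin_glb_lt; lra. }
intros w Hw.
replace (w - 0)%C with w in * by ring.
pose proof (Rmin_l (Rmin r1 r2) (Rmin r3 (e / 2))).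
pose proof (Rmin_r (Rmin r1 r2) (Rmin r3 (e / 2))).
pose proof (Rmin_l r1 r2); pose proof (Rmin_r r1 r2).
pose proof (Rmin_l r3 (e / 2)); pose proof (Rmin_r r3 (e / 2)).
rewrite Cexp_0.
pose proof (re_le_Cmod w) as Hx; pose proof (im_le_Cmod w) as Hy.
destruct w as [x y]; simpl in Hx, Hy.
set (M := Cmod (x, y)) in *.
specialize (H1 x ltac:(lra)); specialize (H2 y ltac:(lra)); specialize (H3 y ltac:(lra)).
rewrite exp_0 in H1; rewrite cos_0 in H2; rewrite sin_0 in H3.
replace (Cexp (x, y) - 1 - 1 * (x, y))%C
  with (exp x * cos y - 1 - x, exp x * sin y - y)
  by (apply injective_projections; simpl; ring).
eapply Rle_trans; [apply Cmod_le_Rabs|]; simpl.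
pose proof (exp_pos x) as Ep.
pose proof (Rabs_pos x); pose proof (Rabs_pos y).
assert (HE : Rabs (exp x - 1) <= 2 * Rabs x).
{ replace (exp x - 1) with ((exp x - 1 - 1 * x) + x) by ring.
  eapply Rle_trans; [apply Rabs_triang|]; nra. }
assert (HE2 : exp x <= 2).
{ apply Rabs_le_between in HE; lra. }
assert (T1 : Rabs (exp x * cos y - 1 - x) <= e * M + 2 * (e * M)).
{ replace (exp x * cos y - 1 - x)
    with ((exp x - 1 - 1 * x) + exp x * (cos y - 1 - 0 * y)) by ring.
  eapply Rle_trans; [apply Rabs_triang|]; rewrite Rabs_mult, (Rabs_pos_eq (exp x)) by lra.
  apply Rplus_le_compat; [nra|].
  apply Rmult_le_compat; try apply Rabs_pos; try lra; nra. }
assert (T2 : Rabs (exp x * sin y - y) <= 2 * (e * M) + e * M).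
{ replace (exp x * sin y - y)
    with (exp x * (sin y - 0 - 1 * y) + (exp x - 1) * y) by ring.
  eapply Rle_trans; [apply Rabs_triang|]; rewrite !Rabs_mult, (Rabs_pos_eq (exp x)) by lra.
  apply Rplus_le_compat.
  - apply Rmult_le_compat; try apply Rabs_pos; try lra; nra.
  - apply Rmult_le_compat; try apply Rabs_pos; lra. }
nra.
Qed.

Lemma Cderiv_ext (h k : C -> C) (z d : C) :
  (forall w, h w = k w) -> Cderiv h z d -> Cderiv k z d.
Proof.
exact (@is_derive_ext C_AbsRing (AbsRing_NormedModule C_AbsRing) h k z d).
Qed.

(** The identity e^w = e^z e^(w - z) moves the derivative at 0 to any point. *)
Lemma Cderiv_Cexp (z : C) : Cderiv Cexp z (Cexp z).
Proof.
(* This is the derivative in the shape that the product and chain rules produce. *)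
replace (Cexp z) with (0 * Cexp (z + - z) + Cexp z * ((1 + 0) * 1))%C
  by (rewrite Cplus_opp_r, Cexp_0; ring).
apply Cderiv_ext with (h := fun w => (Cexp z * Cexp (w + - z))%C).
{ intros w; rewrite <- Cexp_add; f_equal; ring. }
apply (Cderiv_mult (fun _ => Cexp z) (fun w => Cexp (w + - z))%C z); [apply Cderiv_const|].
apply (Cderiv_comp Cexp (fun w => w + - z)%C z 1 (1 + 0)).
- rewrite Cplus_opp_r; apply Cderiv_Cexp_0.
- apply Cderiv_plus; [apply Cderiv_id|apply Cderiv_const].
Qed.

Lemma C1_on_Cexp (D : C -> Prop) : C1_on D Cexp.
Proof.
exists Cexp; intros z _; split; [apply Cderiv_Cexp|].
eapply Cderiv_cont, Cderiv_Cexp.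
Qed.

(** * Complex power series *)


Definition Cseries (u : nat -> C) (l : C) : Prop :=
  @is_series C_AbsRing C_NormedModule u l.

Lemma Cseries_ext (u v : nat -> C) (l : C) : (forall k, u k = v k) -> Cseries u l -> Cseries v l.
Proof. exact (@is_series_ext C_AbsRing C_NormedModule u v l). Qed.

Lemma Cseries_shift (u : nat -> C) (l : C) :
  u 0%nat = 0%C -> Cseries u l -> Cseries (fun k => u (S k)) l.
Proof.
intros Hu H; apply (@is_series_incr_1 C_AbsRing C_NormedModule u l).
rewrite Hu; change (Cseries u (l + 0)%C); rewrite Cplus_0_r; exact H.
Qed.

Lemma Cseries_unshift (u : nat -> C) (l : C) :
  u 0%nat = 0%C -> Cseries (fun k => u (S k)) l -> Cseries u l.
Proof.
intros Hu H; apply (@is_series_decr_1 C_AbsRing C_NormedModule u l).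
rewrite Hu; change (Cseries (fun k => u (S k)) (l + - 0)%C).
replace (l + - 0)%C with l by ring; exact H.
Qed.

Lemma Cseries_minus (u v : nat -> C) (l m : C) :
  Cseries u l -> Cseries v m -> Cseries (fun k => u k - v k)%C (l - m)%C.
Proof. exact (@is_series_minus C_AbsRing C_NormedModule u v l m). Qed.

Lemma Cseries_scal (c : C) (u : nat -> C) (l : C) :
  Cseries u l -> Cseries (fun k => c * u k)%C (c * l)%C.
Proof. exact (@is_series_scal C_AbsRing C_NormedModule c u l). Qed.

Lemma is_pseries_Cseries (a : nat -> C) (z l : C) :
  @is_pseries C_AbsRing C_NormedModule a z l <-> Cseries (fun k => a k * z ^ k)%C l.
Proof.
split; apply Cseries_ext; intros k; [apply Cmult_comm|symmetry; apply Cmult_comm].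
Qed.

Lemma Cmod_Cseries_le (u : nat -> C) (v : nat -> R) (l : C) (s : R) :
  (forall k, Cmod (u k) <= v k) -> Cseries u l -> is_series v s -> Cmod l <= s.
Proof.
intros Huv Hu Hv.
apply (is_lim_seq_le (fun n => Cmod (@sum_n C_NormedModule u n)) (sum_n v) (Cmod l) s).
- intros n; unfold sum_n.
  eapply Rle_trans; [apply (@norm_sum_n_m C_AbsRing C_NormedModule)|].
  apply sum_n_m_le; exact Huv.
- exact (filterlim_comp _ _ _ _ _ _ _ _ Hu
    (@filterlim_norm C_AbsRing C_NormedModule l)).
- exact Hv.
Qed.

(** The partial sums converge, hence are bounded by some M; each term is a difference of two of
    them, hence at most 2 M. *)
Lemma Cseries_terms_bounded (u : nat -> C) (l : C) :
  Cseries u l -> exists M, forall k, Cmod (u k) <= M.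
Proof.
intros H.
destruct (@filterlim_bounded C_AbsRing C_NormedModule _ (ex_intro _ l H)) as [M HM].
exists (M + M); intros [|k].
- specialize (HM 0%nat); rewrite sum_O in HM.
  pose proof (norm_ge_0 (u 0%nat : C_NormedModule)).
  change (Cmod (u 0%nat) <= M) in HM; pose proof (Cmod_ge_0 (u 0%nat)); lra.
- pose proof (HM k) as H1; specialize (HM (S k)); rewrite sum_Sn in HM.
  set (s := @sum_n C_NormedModule u k) in *.
  replace (u (S k)) with ((s + u (S k)) + - s)%C
    by (change (@sum_n C_NormedModule u k) with s; ring).
  eapply Rle_trans; [apply Cmod_triangle|]; rewrite Cmod_opp.
  apply Rplus_le_compat; assumption.
Qed.

(** At a real point r strictly between rho and 1 the series converges, so |a_k| r^k is bounded and
    the radius is at least r. The theory of real power series then applies to the majorant with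
    coefficients |a_k|. *)
Lemma CV_radius_Cmod (a : nat -> C) (f : C -> C) (rho : R) :
  power_series_on_U a f -> 0 <= rho < 1 ->
  Rbar_lt (Rabs rho) (CV_radius (fun k => Cmod (a k))).
Proof.
intros Ha Hrho; rewrite Rabs_pos_eq by lra.
set (r := (1 + rho) / 2).
apply Rbar_lt_le_trans with r; [unfold r; simpl; lra|].
apply (proj1 (CV_radius_bounded (fun k => Cmod (a k)))).
assert (Hr : in_U (RtoC r)).
{ unfold in_U; rewrite Cmod_R, Rabs_pos_eq; unfold r; lra. }
destruct (Cseries_terms_bounded _ _ (proj1 (is_pseries_Cseries _ _ _) (Ha _ Hr))) as [M HM].
exists M; intros k; specialize (HM k).
rewrite Cmod_mult, Cmod_pow, Cmod_R in HM.
rewrite Rabs_mult, <- RPow_abs, (Rabs_pos_eq (Cmod _)) by apply Cmod_ge_0; exact HM.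
Qed.

Definition CPS_derive (a : nat -> C) (k : nat) : C := (RtoC (INR (S k)) * a (S k))%C.

(** Writing R_j for the first-order Taylor remainder of the j-th power, R_(j+1) = w R_j + j z^(j-1)
    (w - z)^2. The constant (k+2)(k+1) is twice the sharp one, so that it matches the coefficients
    of a twice differentiated series. *)
Lemma pow_taylor1_bound (z w : C) (rho : R) (k : nat) :
  Cmod z <= rho -> Cmod w <= rho ->
  Cmod (w ^ S (S k) - z ^ S (S k) - RtoC (INR (S (S k))) * z ^ S k * (w - z))
    <= INR (S (S k)) * INR (S k) * rho ^ k * Cmod (w - z) ^ 2.
Proof.
intros Hz Hw.
assert (H0 : 0 <= rho) by (eapply Rle_trans; [apply Cmod_ge_0|exact Hz]).
induction k as [|k IH].
- replace (w ^ 2 - z ^ 2 - RtoC (INR 2) * z ^ 1 * (w - z))%C with ((w - z) ^ 2)%C.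
  + rewrite Cmod_pow; simpl INR; simpl pow; pose proof (pow2_ge_0 (Cmod (w - z))); nra.
  + simpl INR; rewrite RtoC_plus; ring.
- set (h := Cmod (w - z)) in *.
  replace (w ^ S (S (S k)) - z ^ S (S (S k)) - RtoC (INR (S (S (S k)))) * z ^ S (S k) * (w - z))%C
    with (w * (w ^ S (S k) - z ^ S (S k) - RtoC (INR (S (S k))) * z ^ S k * (w - z))
          + RtoC (INR (S (S k))) * z ^ S k * (w - z) ^ 2)%C.
  2: { rewrite (S_INR (S (S k))), RtoC_plus, !Cpow_S; ring. }
  eapply Rle_trans; [apply Cmod_triangle|].
  rewrite !Cmod_mult, !Cmod_pow, Cmod_R; fold h.
  rewrite (Rabs_pos_eq (INR _)) by apply pos_INR.
  apply Rle_trans with (rho * (INR (S (S k)) * INR (S k) * rho ^ k * h ^ 2)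
    + INR (S (S k)) * rho ^ S k * h ^ 2).
  + apply Rplus_le_compat.
    * apply Rmult_le_compat; auto using Cmod_ge_0.
    * apply Rmult_le_compat_r; [apply pow2_ge_0|].
      apply Rmult_le_compat_l; [apply pos_INR|].
      apply pow_incr; split; [apply Cmod_ge_0|exact Hz].
  + rewrite !S_INR; simpl pow.
    pose proof (pos_INR k); pose proof (pow_le rho k H0).
    assert (0 <= rho * rho ^ k * (h * (h * 1))).
    { apply Rmult_le_pos; [nra|]; nra. }
    nra.
Qed.

(** The Taylor remainders of the terms are summed. They are dominated by |w - z|^2 times the second
    derivative of the majorant series at some rho between |z| and 1, which converges because
    differentiation preserves the radius. *)
Lemma power_series_Cderiv (a : nat -> C) (f : C -> C) (z : C) :
  power_series_on_U a f -> in_U z ->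
  exists d, @is_pseries C_AbsRing C_NormedModule (CPS_derive a) z d /\ Cderiv f z d.
Proof.
intros Ha Hz; unfold in_U in Hz.
pose proof (Cmod_ge_0 z) as Hz0.
set (rho := (1 + Cmod z) / 2).
assert (Hrho : 0 <= rho < 1) by (unfold rho; lra).
pose proof (CV_radius_Cmod a f rho Ha Hrho) as HCV.
set (b := fun k => Cmod (a k)) in *.
rewrite <- CV_radius_derive in HCV.
pose proof (CV_disk_inside _ _ HCV) as Hb1.
rewrite <- CV_radius_derive in HCV.
pose proof (CV_disk_inside _ _ HCV) as Hb2.
assert (Hd : exists d, Cseries (fun k => CPS_derive a k * z ^ k)%C d).
{ apply (@ex_series_le C_AbsRing C_CompleteNormedModule
    (fun k => CPS_derive a k * z ^ k)%C _) with (2 := Hb1).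
  intros k; change (Cmod (CPS_derive a k * z ^ k) <= Rabs (PS_derive b k * rho ^ k)).
  unfold CPS_derive, PS_derive, b.
  rewrite !Cmod_mult, Cmod_pow, Cmod_R, !Rabs_mult, (Rabs_pos_eq (Cmod _)) by apply Cmod_ge_0.
  apply Rmult_le_compat_l.
  - apply Rmult_le_pos; [apply Rabs_pos|apply Cmod_ge_0].
  - rewrite Rabs_pos_eq by (apply pow_le; lra).
    apply pow_incr; unfold rho; lra. }
destruct Hd as [d Hd]; exists d; split; [apply is_pseries_Cseries, Hd|].
destruct Hb2 as [s Hs].
pose proof (Rle_abs s) as Hs1; pose proof (Rabs_pos s) as Hs0.
apply Cderiv_eps; intros eps Heps.
(* The first bound keeps |w| <= rho; the second turns h^2 s into at most eps h. *)
exists (Rmin (rho - Cmod z) (eps / (Rabs s + 1))); split.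
{ apply Rmin_glb_lt; [unfold rho; lra|]; apply Rdiv_lt_0_compat; lra. }
intros w Hw.
pose proof (Rmin_l (rho - Cmod z) (eps / (Rabs s + 1))).
pose proof (Rmin_r (rho - Cmod z) (eps / (Rabs s + 1))).
assert (Hwr : Cmod w <= rho).
{ replace w with (z + (w - z))%C by ring.
  eapply Rle_trans; [apply Cmod_triangle|lra]. }
pose proof (Cmod_ge_0 (w - z)) as Hh0; set (h := Cmod (w - z)) in *.
set (u := fun k => (a k * (w ^ k - z ^ k - RtoC (INR k) * z ^ pred k * (w - z)))%C).
assert (Hu : Cseries u (f w - f z - d * (w - z))%C).
{ apply (Cseries_ext (fun k => (a k * w ^ k - a k * z ^ k
    - (w - z) * (RtoC (INR k) * a k * z ^ pred k)))%C).
  { intros k; unfold u; ring. }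
  replace (d * (w - z))%C with ((w - z) * d)%C by ring.
  apply Cseries_minus; [apply Cseries_minus|].
  - apply is_pseries_Cseries, Ha; unfold in_U; lra.
  - apply is_pseries_Cseries, Ha; exact Hz.
  - apply Cseries_scal, Cseries_unshift; [simpl; ring|exact Hd]. }
(* The remainders of the powers 0 and 1 vanish; dropping them aligns the indices with
   [pow_taylor1_bound] and the twice differentiated majorant. *)
apply Cseries_shift in Hu; [|unfold u; simpl; ring].
apply Cseries_shift in Hu; [|unfold u; simpl; ring].
apply Rle_trans with (h ^ 2 * s).
- apply (Cmod_Cseries_le _ _ _ _) with (2 := Hu)
    (3 := @is_series_scal R_AbsRing R_NormedModule (h ^ 2) _ _ Hs).
  intros k; change (@scal R_AbsRing R_NormedModule) with Rmult; unfold u.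
  rewrite Cmod_mult.
  eapply Rle_trans.
  { apply Rmult_le_compat_l; [apply Cmod_ge_0|].
    apply (pow_taylor1_bound z w rho); [unfold rho; lra|exact Hwr]. }
  fold h; rewrite Rabs_pos_eq.
  + unfold PS_derive, b; right; ring.
  + unfold PS_derive, b; repeat apply Rmult_le_pos; auto using pos_INR, Cmod_ge_0.
    apply pow_le; lra.
- assert (h * (Rabs s + 1) <= eps).
  { replace eps with (eps / (Rabs s + 1) * (Rabs s + 1)) by (field; lra).
    apply Rmult_le_compat_r; lra. }
  nra.
Qed.

Lemma power_series_C_derive (a : nat -> C) (f : C -> C) :
  power_series_on_U a f ->
  power_series_on_U (CPS_derive a) (C_derive f) /\
  forall z, in_U z -> Cderiv f z (C_derive f z).
Proof.
intros Ha; split; intros z Hz;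
  destruct (power_series_Cderiv a f z Ha Hz) as [d [H1 H2]];
  rewrite (C_derive_Cderiv _ _ _ H2); assumption.
Qed.

Lemma power_series_C1 (a : nat -> C) (f : C -> C) :
  power_series_on_U a f -> C1_on in_U f.
Proof.
intros Ha; destruct (power_series_C_derive a f Ha) as [Ha' Hd].
exists (C_derive f); intros z Hz; split; [exact (Hd z Hz)|].
apply (Cderiv_cont _ _ _ (proj2 (power_series_C_derive _ _ Ha') z Hz)).
Qed.

(** * Expansions at 0 and branches of powers *)


Lemma power_series_shift (b : nat -> C) (h : C -> C) :
  power_series_on_U b h ->
  power_series_on_U (fun k => b (S k))
    (fun z => if Ceq_dec z 0 then b 1%nat else ((h z - b 0%nat) / z)%C).
Proof.
intros Hb z Hz; destruct (Ceq_dec z 0) as [->|Hz0].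
- exact (@is_pseries_0 C_AbsRing C_NormedModule (fun k => b (S k))).
- pose proof (@is_pseries_decr_1 C_AbsRing C_NormedModule b z (/ z)%C (h z)
    (Cinv_l z Hz0) (Hb z Hz)) as H.
  replace ((h z - b 0%nat) / z)%C with (/ z * (h z - b 0%nat))%C by (unfold Cdiv; ring).
  exact H.
Qed.

(* [h z = c0 + c z^m + o(z^m)] at 0. *)
Definition expands (m : nat) (c0 c : C) (h : C -> C) : Prop :=
  exists r : C -> C, Ccont r 0 /\ r 0%C = c /\
    exists rho, 0 < rho /\ forall z, Cmod z < rho -> h z = (c0 + z ^ m * r z)%C.

Lemma expands_eq m c0 c d0 d h :
  c0 = d0 -> c = d -> expands m c0 c h -> expands m d0 d h.
Proof. now intros -> ->. Qed.

(** One factor z is divided out at a time: when the constant coefficient of the current quotient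
    vanishes, [power_series_shift] gives the next quotient as a power series on the disc. *)
Lemma power_series_factor (b : nat -> C) (h : C -> C) (m : nat) :
  power_series_on_U b h -> (forall k, (1 <= k <= m)%nat -> b k = 0%C) ->
  exists r, power_series_on_U (fun k => b (S m + k)%nat) r /\ r 0%C = b (S m) /\
    forall z, in_U z -> h z = (b 0%nat + z ^ S m * r z)%C.
Proof.
intros Hb; induction m as [|m IH]; intros H0.
- exists (fun z => if Ceq_dec z 0 then b 1%nat else ((h z - b 0%nat) / z)%C).
  repeat split.
  + exact (power_series_shift b h Hb).
  + destruct (Ceq_dec 0 0); [reflexivity|congruence].
  + intros z Hz; destruct (Ceq_dec z 0) as [->|Hz0].
    * replace (b 0%nat + 0 ^ 1 * b 1%nat)%C with (b 0%nat) by (simpl; ring).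
      pose proof (@is_pseries_0 C_AbsRing C_NormedModule b) as H1.
      exact (filterlim_locally_unique _ _ _ (Hb _ Hz) H1).
    * simpl; field; exact Hz0.
- destruct IH as [r [Hr [Hr0 Hh]]]; [intros k Hk; apply H0; lia|].
  exists (fun z => if Ceq_dec z 0 then b (S (S m)) else ((r z - b (S m)) / z)%C).
  repeat split.
  + intros z Hz; pose proof (power_series_shift _ _ Hr z Hz) as H; cbv beta in H.
    replace (S m + 1)%nat with (S (S m)) in H by lia.
    replace (S m + 0)%nat with (S m) in H by lia.
    revert H; apply is_pseries_ext; intros k; f_equal; lia.
  + destruct (Ceq_dec 0 0); [reflexivity|congruence].
  + intros z Hz; rewrite (Hh z Hz).
    rewrite (H0 (S m)) by lia.
    destruct (Ceq_dec z 0) as [->|Hz0].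
    * rewrite !Cpow_S; ring.
    * rewrite !Cpow_S; field; exact Hz0.
Qed.

Lemma power_series_expands (b : nat -> C) (h : C -> C) (m : nat) :
  power_series_on_U b h -> (1 <= m)%nat ->
  (forall k, (1 <= k < m)%nat -> b k = 0%C) -> expands m (b 0%nat) (b m) h.
Proof.
intros Hb Hm H0; destruct m as [|m]; [lia|].
destruct (power_series_factor b h m Hb) as [r [Hr [Hr0 Hh]]].
{ intros k Hk; apply H0; lia. }
exists r; repeat split.
- apply (C1_on_cont in_U); [eapply power_series_C1, Hr|].
  unfold in_U; rewrite Cmod_0; lra.
- exact Hr0.
- exists 1; split; [lra|]; exact Hh.
Qed.

Lemma Ccont_pow (m : nat) (z : C) : Ccont (fun x => x ^ m)%C z.
Proof.
induction m as [|m IH].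
- apply Ccont_const.
- change (Ccont (fun x => x * x ^ m)%C z).
  apply Ccont_mult; [eapply Cderiv_cont, Cderiv_id|exact IH].
Qed.

Lemma expands_const (m : nat) (c : C) : expands m c 0 (fun _ => c).
Proof.
exists (fun _ => 0%C); repeat split; [apply Ccont_const|].
exists 1; split; [lra|]; intros z _; ring.
Qed.

Lemma expands_plus m c0 c d0 d h k :
  expands m c0 c h -> expands m d0 d k ->
  expands m (c0 + d0)%C (c + d)%C (fun z => h z + k z)%C.
Proof.
intros [r [Hr [Hr0 [p [Hp Hh]]]]] [s [Hs [Hs0 [q [Hq Hk]]]]].
exists (fun z => r z + s z)%C; repeat split.
- now apply Ccont_plus.
- now rewrite Hr0, Hs0.
- exists (Rmin p q); split; [now apply Rmin_glb_lt|].
  intros z Hz; rewrite Hh, Hk; [ring| |].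
  + eapply Rlt_le_trans; [exact Hz|apply Rmin_r].
  + eapply Rlt_le_trans; [exact Hz|apply Rmin_l].
Qed.

Lemma expands_mult m c0 c d0 d h k :
  (1 <= m)%nat -> expands m c0 c h -> expands m d0 d k ->
  expands m (c0 * d0)%C (c0 * d + c * d0)%C (fun z => h z * k z)%C.
Proof.
intros Hm [r [Hr [Hr0 [p [Hp Hh]]]]] [s [Hs [Hs0 [q [Hq Hk]]]]].
exists (fun z => c0 * s z + r z * d0 + z ^ m * (r z * s z))%C; repeat split.
- apply Ccont_plus; [apply Ccont_plus; apply Ccont_mult|].
  + apply Ccont_const.
  + exact Hs.
  + exact Hr.
  + apply Ccont_const.
  + apply Ccont_mult; [apply Ccont_pow|exact (Ccont_mult _ _ _ Hr Hs)].
- rewrite Hr0, Hs0; destruct m; [lia|]; rewrite Cpow_S; ring.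
- exists (Rmin p q); split; [now apply Rmin_glb_lt|].
  intros z Hz; rewrite Hh, Hk; [ring| |].
  + eapply Rlt_le_trans; [exact Hz|apply Rmin_r].
  + eapply Rlt_le_trans; [exact Hz|apply Rmin_l].
Qed.

Lemma expands_mul_id m c h :
  expands m 0 c h -> expands (S m) 0 c (fun z => z * h z)%C.
Proof.
intros [r [Hr [Hr0 [p [Hp Hh]]]]].
exists r; repeat split; try assumption; exists p; split; [assumption|].
intros z Hz; rewrite (Hh z Hz), Cpow_S; ring.
Qed.

(** [phi] is the difference quotient, completed by [d] at 0. The identity then holds at every [w],
    so an inner function that may vanish can be substituted without case distinction. *)
Lemma Cderiv_0_factor (h : C -> C) (d : C) :
  Cderiv h 0 d -> exists phi, Ccont phi 0 /\ phi 0%C = d /\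
    forall w, h w = (h 0 + w * phi w)%C.
Proof.
intros H.
exists (fun w => if Ceq_dec w 0 then d else ((h w - h 0) / w)%C); repeat split.
- apply Ccont_eps; intros eps Heps.
  apply Cderiv_eps with (eps := eps / 2) in H; [|lra].
  destruct H as [r [Hr H]]; exists r; split; [exact Hr|]; intros w Hw.
  destruct (Ceq_dec 0 0) as [_|]; [|congruence].
  destruct (Ceq_dec w 0) as [_|Hw0].
  + replace (d - d)%C with (RtoC 0) by ring; rewrite Cmod_0; exact Heps.
  + specialize (H w Hw).
    replace (w - 0)%C with w in H by ring.
    replace ((h w - h 0) / w - d)%C with ((h w - h 0 - d * w) / w)%C by (field; exact Hw0).
    rewrite Cmod_div by exact Hw0.
    apply Rle_lt_trans with (eps / 2); [|lra].
    apply Cmod_gt_0 in Hw0.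
    apply Rle_div_l; assumption.
- destruct (Ceq_dec 0 0); [reflexivity|congruence].
- intros w; destruct (Ceq_dec w 0) as [->|Hw0]; [ring|field; exact Hw0].
Qed.

(** Since e^h = 1 + h phi(h) with phi continuous and phi(0) = 1, the factor [r] of h only gets
    multiplied by a function tending to 1. *)
Lemma expands_Cexp m c h :
  (1 <= m)%nat -> Ccont h 0 -> expands m 0 c h -> expands m 1 c (fun z => Cexp (h z)).
Proof.
intros Hm Hc [r [Hr [Hr0 [p [Hp Hh]]]]].
destruct (Cderiv_0_factor Cexp 1 Cderiv_Cexp_0) as [phi [Hphi [Hphi0 E]]].
assert (H0 : h 0%C = 0%C).
{ rewrite Hh by (rewrite Cmod_0; exact Hp); destruct m; [lia|]; rewrite Cpow_S; ring. }
exists (fun z => r z * phi (h z))%C; repeat split.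
- apply Ccont_mult; [exact Hr|]; apply Ccont_comp; [exact Hc|]; rewrite H0; exact Hphi.
- rewrite H0, Hphi0, Hr0; ring.
- exists p; split; [exact Hp|]; intros z Hz.
  (* Abstracting [phi (h z)] confines the expansion of [h z] to the outer factor. *)
  rewrite E, Cexp_0; generalize (phi (h z)); intros w; rewrite (Hh z Hz); ring.
Qed.

Lemma Ccont_neq_0 (h : C -> C) (z : C) :
  Ccont h z -> h z <> 0%C -> exists r, 0 < r /\
    forall w, Cmod (w - z) < r -> Cmod (h z) / 2 < Cmod (h w).
Proof.
intros H Hz; apply Cmod_gt_0 in Hz.
apply Ccont_eps with (eps := Cmod (h z) / 2) in H; [|lra].
destruct H as [r [Hr H]]; exists r; split; [exact Hr|]; intros w Hw.
specialize (H w Hw).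
pose proof (Cmod_triangle (h w) (- (h w - h z))) as T.
rewrite Cmod_opp in T; replace (h w + - (h w - h z))%C with (h z) in T by ring; lra.
Qed.

Lemma Ccont_inv (h : C -> C) (z : C) :
  Ccont h z -> h z <> 0%C -> Ccont (fun w => / h w)%C z.
Proof.
intros H Hz; destruct (Ccont_neq_0 h z H Hz) as [r1 [Hr1 H1]].
apply Ccont_eps; intros eps Heps.
pose proof (proj1 (Cmod_gt_0 _) Hz) as Hp; set (M := Cmod (h z)) in *.
apply Ccont_eps with (eps := eps * (M / 2 * M)) in H;
  [|apply Rmult_lt_0_compat; [|apply Rmult_lt_0_compat]; lra].
destruct H as [r2 [Hr2 H2]].
exists (Rmin r1 r2); split; [now apply Rmin_glb_lt|]; intros w Hw.
specialize (H1 w (Rlt_le_trans _ _ _ Hw (Rmin_l _ _))).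
specialize (H2 w (Rlt_le_trans _ _ _ Hw (Rmin_r _ _))).
assert (Hw0 : h w <> 0%C) by (apply Cmod_gt_0; lra).
replace (/ h w - / h z)%C with (- (h w - h z) / (h w * h z))%C by (field; auto).
rewrite Cmod_div, Cmod_opp, Cmod_mult by (apply Cmult_neq_0; assumption).
fold M; apply Rlt_div_l; [apply Rlt_gt, Rmult_lt_0_compat; lra|].
eapply Rlt_le_trans; [exact H2|].
apply Rmult_le_compat_l; [lra|]; apply Rmult_le_compat_r; lra.
Qed.

(** From 1 + L phi(L) = q = 1 + z^m r one gets L = z^m r / phi(L); near 0 the divisor is nonzero,
    and its value at 0 is 1. *)
Lemma expands_log m c q L :
  Ccont L 0 -> L 0%C = 0%C -> (forall z, in_U z -> Cexp (L z) = q z) ->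
  expands m 1 c q -> expands m 0 c L.
Proof.
intros HL HL0 Hq [r [Hr [Hr0 [p [Hp Hh]]]]].
destruct (Cderiv_0_factor Cexp 1 Cderiv_Cexp_0) as [phi [Hphi [Hphi0 E]]].
assert (Hc : Ccont (fun z => phi (L z)) 0).
{ apply Ccont_comp; [exact HL|rewrite HL0; exact Hphi]. }
assert (Hn : phi (L 0%C) <> 0%C).
{ rewrite HL0, Hphi0; apply C1_nz. }
destruct (Ccont_neq_0 _ _ Hc Hn) as [s [Hs Hsn]].
exists (fun z => r z * / phi (L z))%C; repeat split.
- apply Ccont_mult; [exact Hr|]; apply (Ccont_inv (fun z => phi (L z))); assumption.
- rewrite HL0, Hphi0, Hr0; field.
- exists (Rmin (Rmin p s) 1); split; [repeat apply Rmin_glb_lt; lra|]; intros z Hz.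
  pose proof (Rmin_l (Rmin p s) 1); pose proof (Rmin_r (Rmin p s) 1).
  pose proof (Rmin_l p s); pose proof (Rmin_r p s).
  assert (Hz0 : phi (L z) <> 0%C).
  { apply Cmod_gt_0; eapply Rle_lt_trans; [|apply Hsn].
    - pose proof (Cmod_ge_0 (phi (L 0%C))); lra.
    - replace (z - 0)%C with z by ring; lra. }
  assert (Hzq : (1 + L z * phi (L z) = 1 + z ^ m * r z)%C).
  { rewrite <- Hh by lra; rewrite <- Hq by (unfold in_U; lra).
    rewrite (E (L z)), Cexp_0; reflexivity. }
  assert (Hz1 : (L z * phi (L z) = z ^ m * r z)%C).
  { replace (L z * phi (L z))%C with ((1 + L z * phi (L z)) - 1)%C by ring.
    rewrite Hzq; ring. }
  replace (L z) with ((L z * phi (L z)) / phi (L z))%C at 1 by (field; exact Hz0).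
  rewrite Hz1; field; exact Hz0.
Qed.

(** Differentiating e^L = q gives L' = q' e^(-L), whose right side is continuous. Thus mere
    differentiability of L upgrades to a continuous derivative. *)
Lemma C1_on_log (q L : C -> C) :
  analytic_U L -> (forall z, in_U z -> Cexp (L z) = q z) -> C1_on in_U q -> C1_on in_U L.
Proof.
intros HL Hq [q' Hq'].
assert (HLd : forall z, in_U z -> Cderiv L z (C_derive L z)).
{ intros z Hz; apply Cderiv_iff, C_derive_correct; [exact 0%C|exact (HL z Hz)]. }
assert (E : forall z, in_U z -> C_derive L z = (q' z * Cexp (- L z))%C).
{ intros z Hz; destruct (Hq' z Hz) as [H1 _].
  assert (H2 : Cderiv q z (C_derive L z * Cexp (L z))%C).
  { apply (@is_derive_ext_loc C_AbsRing (AbsRing_NormedModule C_AbsRing)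
      (fun w => Cexp (L w))).
    - assert (Hr : 0 < 1 - Cmod z) by (unfold in_U in Hz; lra).
      exists (mkposreal _ Hr); intros w Hw; apply Hq; unfold in_U.
      change (Cmod (w - z) < 1 - Cmod z) in Hw.
      replace w with (z + (w - z))%C by ring.
      eapply Rle_lt_trans; [apply Cmod_triangle|lra].
    - exact (Cderiv_comp Cexp L z _ _ (Cderiv_Cexp _) (HLd z Hz)). }
  apply C_derive_Cderiv in H1; apply C_derive_Cderiv in H2.
  rewrite <- H1, H2, <- Cmult_assoc, <- Cexp_add, Cplus_opp_r, Cexp_0; ring. }
exists (fun z => q' z * Cexp (- 1 * L z))%C; intros z Hz; split.
- replace (q' z * Cexp (- 1 * L z))%C with (C_derive L z); [exact (HLd z Hz)|].
  rewrite (E z Hz); do 2 f_equal; ring.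
- apply Ccont_mult; [apply Hq', Hz|].
  apply (Ccont_comp Cexp (fun z => - 1 * L z)%C).
  + apply Ccont_mult; [apply Ccont_const|eapply Cderiv_cont, HLd, Hz].
  + eapply Cderiv_cont, Cderiv_Cexp.
Qed.

(** The expansion passes from q = 1 + c z^m to L = c z^m, to s L, and to e^(s L) = 1 + s c z^m, up
    to o(z^m). [P] is prescribed on the disc only; [P'] is the exponential formula taken
    everywhere. *)
Lemma power_branch_expands (q P : C -> C) (s : R) (m : nat) (c : C) :
  (1 <= m)%nat -> power_branch q s P -> C1_on in_U q -> expands m 1 c q ->
  exists P', (forall z, in_U z -> P z = P' z) /\ C1_on in_U P' /\
    expands m 1 (RtoC s * c)%C P'.
Proof.
intros Hm [L [HL [HL0 [HLq HP]]]] Hq Hc.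
pose proof (C1_on_log q L HL HLq Hq) as HL1.
assert (HLs : C1_on in_U (fun z => RtoC s * L z)%C).
{ apply C1_on_mult; [apply C1_on_const|exact HL1]. }
assert (H0 : in_U 0) by (unfold in_U; rewrite Cmod_0; lra).
exists (fun z => Cexp (RtoC s * L z)); repeat split.
- exact HP.
- apply (C1_on_comp _ (fun _ => True) Cexp (fun z => RtoC s * L z)%C); auto.
  apply C1_on_Cexp.
- apply expands_Cexp; [exact Hm|exact (C1_on_cont _ _ _ HLs H0)|].
  refine (expands_eq _ _ _ _ _ _ _ _
    (expands_mult _ _ _ 0 c _ L Hm (expands_const m (RtoC s)) _)); [ring|ring|].
  apply (expands_log m c q); auto.
  exact (C1_on_cont _ _ _ HL1 H0).
Qed.

(** * Integrals over vertical segments *)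


(** Common source of the partial derivatives below: [v] is 1 or i according to the direction, and
    [c] is 1 to read the real part or -i to read the imaginary part. *)
Lemma Cderiv_along_line (h : C -> C) (z v c d : C) (s : R) :
  Cderiv h (z + RtoC s * v)%C d ->
  is_derive (fun x : R => Re (c * h (z + RtoC x * v))%C) s (Re (c * d * v)%C).
Proof.
intros H; apply is_derive_Reals; intros eps Heps.
(* Adding 1 keeps the divisors positive even when [c] or [v] is 0. *)
set (M := (Cmod c + 1) * (Cmod v + 1)).
pose proof (Cmod_ge_0 c); pose proof (Cmod_ge_0 v).
assert (HM : 0 < M) by (unfold M; apply Rmult_lt_0_compat; lra).
destruct (proj1 (Cderiv_eps _ _ _) H (eps / 2 / M)) as [r [Hr Hh]].
{ apply Rdiv_lt_0_compat; lra. }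
assert (Hd : 0 < r / (Cmod v + 1)) by (apply Rdiv_lt_0_compat; lra).
exists (mkposreal _ Hd); intros x Hx0 Hx; simpl in Hx.
set (w := (z + RtoC (s + x) * v)%C); set (w0 := (z + RtoC s * v)%C) in *.
assert (Hw : (w - w0 = RtoC x * v)%C) by (unfold w, w0; rewrite RtoC_plus; ring).
assert (Hxv : Rabs x * (Cmod v + 1) < r).
{ apply Rmult_lt_compat_r with (r := Cmod v + 1) in Hx; [|lra].
  replace (r / (Cmod v + 1) * (Cmod v + 1)) with r in Hx by (field; lra); exact Hx. }
pose proof (Rabs_pos_lt x Hx0).
specialize (Hh w); rewrite Hw, Cmod_mult, Cmod_R in Hh.
specialize (Hh ltac:(nra)).
replace ((Re (c * h w) - Re (c * h w0)) / x - Re (c * d * v))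
  with (Re (c * (h w - h w0 - d * (RtoC x * v)))%C / x).
2: { replace (c * (h w - h w0 - d * (RtoC x * v)))%C
       with (c * h w - c * h w0 - RtoC x * (c * d * v))%C by ring.
     unfold Re at 1; simpl; unfold Re; simpl; field; exact Hx0. }
unfold Rdiv; rewrite Rabs_mult, Rabs_inv; apply Rlt_div_l; [lra|].
eapply Rle_lt_trans; [apply re_le_Cmod|]; rewrite Cmod_mult.
apply Rle_lt_trans with ((Cmod c + 1) * (eps / 2 / M * (Rabs x * (Cmod v + 1)))).
- apply Rmult_le_compat; try apply Cmod_ge_0; [lra|].
  eapply Rle_trans; [exact Hh|]; apply Rmult_le_compat_l.
  + apply Rlt_le, Rdiv_lt_0_compat; lra.
  + apply Rmult_le_compat_l; lra.
- replace ((Cmod c + 1) * (eps / 2 / M * (Rabs x * (Cmod v + 1))))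
    with (eps / 2 * Rabs x) by (unfold M; field; lra).
  nra.
Qed.

Lemma is_derive_Re_fst (h : C -> C) (s t : R) (d : C) :
  Cderiv h (s, t) d -> is_derive (fun x => Re (h (x, t))) s (Re d).
Proof.
intros H.
replace (s, t) with ((0, t) + RtoC s * 1)%C in H
  by (apply injective_projections; simpl; ring).
pose proof (Cderiv_along_line h (0, t) 1 1 d s H) as H1.
replace (Re d) with (Re (1 * d * 1)%C) by (f_equal; ring).
revert H1; apply is_derive_ext; intros x; change R in x.
replace ((0, t) + RtoC x * 1)%C with ((x, t) : C)
  by (apply injective_projections; simpl; ring).
now rewrite Cmult_1_l.
Qed.

(** The derivative is the same [Re d] as in [is_derive_Re_fst]: this is the Cauchy-Riemann equation
    that makes the vertical integrals constant. *)
Lemma is_derive_Im_snd (h : C -> C) (s t : R) (d : C) :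
  Cderiv h (s, t) d -> is_derive (fun x => Im (h (s, x))) t (Re d).
Proof.
intros H.
replace (s, t) with ((s, 0) + RtoC t * Ci)%C in H
  by (apply injective_projections; simpl; ring).
pose proof (Cderiv_along_line h (s, 0) Ci (- Ci) d t H) as H1.
replace (Re d) with (Re (- Ci * d * Ci)%C)
  by (destruct d; unfold Re; simpl; ring).
revert H1; apply is_derive_ext; intros x; change R in x.
replace ((s, 0) + RtoC x * Ci)%C with ((s, x) : C)
  by (apply injective_projections; simpl; ring).
unfold Re, Im; simpl; ring.
Qed.

Lemma is_derive_Re_snd (h : C -> C) (s t : R) (d : C) :
  Cderiv h (s, t) d -> is_derive (fun x => Re (h (s, x))) t (- Im d).
Proof.
intros H.
replace (s, t) with ((s, 0) + RtoC t * Ci)%C in H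
  by (apply injective_projections; simpl; ring).
pose proof (Cderiv_along_line h (s, 0) Ci 1 d t H) as H1.
replace (- Im d) with (Re (1 * d * Ci)%C)
  by (destruct d; unfold Re, Im; simpl; ring).
revert H1; apply is_derive_ext; intros x; change R in x.
replace ((s, 0) + RtoC x * Ci)%C with ((s, x) : C)
  by (apply injective_projections; simpl; ring).
now rewrite Cmult_1_l.
Qed.

Lemma Ccont_continuity_2d (h : C -> C) (s t : R) :
  Ccont h (s, t) -> continuity_2d_pt (fun u v => Re (h (u, v))) s t.
Proof.
intros H eps; destruct (proj1 (Ccont_eps _ _) H eps (cond_pos eps)) as [r [Hr Hh]].
assert (Hr2 : 0 < r / 2) by lra.
exists (mkposreal _ Hr2); simpl; intros u v Hu Hv.
eapply Rle_lt_trans; [|apply (Hh (u, v))].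
- exact (re_le_Cmod (h (u, v) - h (s, t))%C).
- eapply Rle_lt_trans; [apply Cmod_le_Rabs|].
  unfold Re, Im; simpl; fold (u - s) (v - t); lra.
Qed.

Definition left_half_plane (z : C) : Prop := Re z < 0.

Lemma ex_RInt_Re_vertical (K : C -> C) (s a b : R) :
  C1_on left_half_plane K -> s < 0 -> ex_RInt (fun t => Re (K (s, t))) a b.
Proof.
intros [K' HK] Hs; apply (@ex_RInt_continuous R_CompleteNormedModule); intros t _.
apply (@ex_derive_continuous R_AbsRing R_NormedModule).
eexists; apply is_derive_Re_snd, HK; exact Hs.
Qed.

(** Differentiating under the integral in s gives the integral of Re K'(s + it), which by
    Cauchy-Riemann is the t-derivative of Im K. It integrates to Im K(s + iT) - Im K(s), which is 0
    by periodicity. *)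
Lemma RInt_vertical_const (K : C -> C) (T s1 s2 : R) :
  C1_on left_half_plane K ->
  (forall s, s < 0 -> K (s, T) = K (s, 0)) -> s1 < s2 < 0 ->
  RInt (fun t => Re (K (s1, t))) 0 T = RInt (fun t => Re (K (s2, t))) 0 T.
Proof.
intros HK1 Hper Hs.
apply (eq_is_derive (V := R_NormedModule) (fun s => RInt (fun t => Re (K (s, t))) 0 T));
  [|lra].
intros s Hs'; assert (Hs0 : s < 0) by lra.
destruct HK1 as [K' HK].
assert (HD : forall u v, u < 0 -> Derive (fun x => Re (K (x, v))) u = Re (K' (u, v))).
{ intros u v Hu; apply is_derive_unique, is_derive_Re_fst, HK, Hu. }
assert (Hloc : locally s (fun u => u < 0)).
{ apply (open_lt 0 s Hs0). }
replace (@zero R_NormedModule) with (RInt (fun t => Derive (fun u => Re (K (u, t))) s) 0 T).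
- apply is_derive_RInt_param.
  + revert Hloc; apply filter_imp; intros u Hu t _.
    eexists; apply is_derive_Re_fst, HK, Hu.
  + intros t _.
    apply continuity_2d_pt_ext_loc with (f := fun u v => Re (K' (u, v))).
    * assert (Hm : 0 < - s) by lra.
      exists (mkposreal _ Hm); simpl; intros u v Hu _; symmetry; apply HD.
      apply Rabs_lt_between in Hu; lra.
    * apply Ccont_continuity_2d, HK, Hs0.
  + revert Hloc; apply filter_imp; intros u Hu.
    apply ex_RInt_Re_vertical; [exists K'; exact HK|exact Hu].
- rewrite (RInt_ext _ (fun t => Re (K' (s, t)))) by (intros t _; apply HD, Hs0).
  apply is_RInt_unique.
  replace (@zero R_NormedModule) with (@minus R_NormedModule (Im (K (s, T))) (Im (K (s, 0)))).
  + apply (is_RInt_derive (V := R_CompleteNormedModule) (fun t => Im (K (s, t)))).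
    * intros t _; apply is_derive_Im_snd, HK, Hs0.
    * intros t _.
      assert (Hc := Ccont_continuity_2d K' s t (proj2 (HK (s, t) Hs0))).
      apply continuity_2d_pt_filterlim in Hc.
      refine (filterlim_comp _ _ _ (fun x => (s, x)) _ _ _ _ _ Hc).
      intros P [eps HP]; exists eps; intros y Hy; apply HP; split; [|exact Hy].
      apply ball_center.
  + rewrite Hper by exact Hs0; exact (@minus_eq_zero R_AbelianGroup _).
Qed.

(** * Caratheodory's coefficient bound *)


Lemma Cexp_opp (z : C) : Cexp (- z) = (/ Cexp z)%C.
Proof.
assert (H : (Cexp z * Cexp (- z) = 1)%C) by (rewrite <- Cexp_add, Cplus_opp_r; apply Cexp_0).
replace (/ Cexp z)%C with (/ Cexp z * (Cexp z * Cexp (- z)))%C by (rewrite H; ring).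
field; apply Cexp_neq_0.
Qed.

(* The integral over [0, 2 pi] is independent of [s]; its value is read off as
   [s -> -oo], where [exp (s + i t)] tends to 0 uniformly in [t]. *)
Lemma RInt_vertical_le (K T : C -> C) (s0 : R) (l : C) :
  C1_on left_half_plane K -> (forall s, s < 0 -> K (s, 2 * PI) = K (s, 0)) -> s0 < 0 ->
  Ccont T 0 -> T 0%C = l ->
  (exists rho, 0 < rho /\ forall z, Cmod (Cexp z) < rho -> K z = T (Cexp z)) ->
  RInt (fun t => Re (K (s0, t))) 0 (2 * PI) <= 2 * PI * Re l.
Proof.
intros HK Hper Hs0 HT HT0 [rho [Hrho HKT]].
pose proof PI_RGT_0 as Hpi.
apply Rnot_lt_le; intros Habs.
set (I := RInt (fun t => Re (K (s0, t))) 0 (2 * PI)) in *.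
(* Half the supposed excess of the mean of the integrand over Re l. *)
set (eps := (I - 2 * PI * Re l) / (2 * PI) / 2).
assert (Heps : 0 < eps).
{ unfold eps; apply Rdiv_lt_0_compat; [|lra]; apply Rdiv_lt_0_compat; lra. }
destruct (proj1 (Ccont_eps _ _) HT eps Heps) as [r [Hr Hc]].
(* Far enough left that s < s0 and e^s lies below both radii; each -1 makes an inequality strict. *)
set (s := Rmin (s0 - 1) (ln (Rmin r rho) - 1)).
pose proof (Rmin_l (s0 - 1) (ln (Rmin r rho) - 1)) as Hs1.
pose proof (Rmin_r (s0 - 1) (ln (Rmin r rho) - 1)) as Hs2.
fold s in Hs1, Hs2.
assert (Hmin : 0 < Rmin r rho) by (now apply Rmin_glb_lt).
assert (Hes : exp s < Rmin r rho).
{ rewrite <- (exp_ln (Rmin r rho)) by exact Hmin; apply exp_increasing; lra. }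
pose proof (Rmin_l r rho); pose proof (Rmin_r r rho).
assert (HI : I = RInt (fun t => Re (K (s, t))) 0 (2 * PI)).
{ symmetry; apply RInt_vertical_const; [exact HK|exact Hper|lra]. }
assert (HIle : I <= RInt (fun _ => Re l + eps) 0 (2 * PI)).
{ rewrite HI; apply RInt_le; [lra|apply ex_RInt_Re_vertical; [exact HK|lra]|apply ex_RInt_const|].
  intros t _.
  assert (Hm : Cmod (Cexp (s, t)) = exp s) by (rewrite Cmod_Cexp; reflexivity).
  rewrite HKT by lra.
  specialize (Hc (Cexp (s, t))).
  replace (Cexp (s, t) - 0)%C with (Cexp (s, t)) in Hc by ring.
  specialize (Hc ltac:(lra)); rewrite HT0 in Hc.
  pose proof (re_le_Cmod (T (Cexp (s, t)) - l)) as Hre.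
  apply Rabs_le_between in Hre.
  replace (Re (T (Cexp (s, t)) - l)%C) with (Re (T (Cexp (s, t))) - Re l) in Hre
    by (unfold Re; simpl; ring).
  lra. }
rewrite RInt_const in HIle.
change (I <= (2 * PI - 0) * (Re l + eps)) in HIle.
assert (2 * PI * eps = (I - 2 * PI * Re l) / 2) by (unfold eps; field; lra).
nra.
Qed.

Lemma is_RInt_trig_kernel (m : nat) (k p q : R) :
  (1 <= m)%nat ->
  is_RInt (fun t => k * (1 - (p * cos (INR m * t) + q * sin (INR m * t)))) 0 (2 * PI)
    (k * (2 * PI)).
Proof.
intros Hm; assert (Hm0 : 0 < INR m) by (apply lt_0_INR; lia).
(* An antiderivative; its trigonometric part takes equal values at 0 and 2 pi because m is an
   integer. *)
set (G := fun t => k * (t - (p * sin (INR m * t) - q * cos (INR m * t)) / INR m)).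
replace (k * (2 * PI)) with (@minus R_NormedModule (G (2 * PI)) (G 0)).
- apply (is_RInt_derive (V := R_CompleteNormedModule) G).
  + intros t _; unfold G; auto_derive; [exact I|]; field; lra.
  + intros t _; apply (@ex_derive_continuous R_AbsRing R_NormedModule).
    auto_derive; exact I.
- change (G (2 * PI) - G 0 = k * (2 * PI)); unfold G.
  replace (INR m * (2 * PI)) with (0 + 2 * INR m * PI) by ring.
  rewrite cos_period, sin_period, Rmult_0_r, sin_0, cos_0; field; lra.
Qed.

Lemma first_coeff_exp_bound (F : C -> C) (m : nat) (c : C) (alpha s0 : R) :
  (1 <= m)%nat -> C1_on in_U F -> expands m 1 c F ->
  (forall z, in_U z -> alpha < Re (F z)) -> c <> 0%C -> s0 < 0 ->
  Cmod c * exp (INR m * s0) <= 2 * (1 - alpha).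
Proof.
intros Hm HF [r [Hr [Hr0 [rho [Hrho HFr]]]]] Halpha Hc Hs0.
pose proof PI_RGT_0 as Hpi.
pose proof (proj1 (Cmod_gt_0 _) Hc) as Hc0.
set (w := (Cconj c / RtoC (Cmod c))%C).
assert (Hcr : RtoC (Cmod c) <> 0%C) by (intros E; apply RtoC_inj in E; lra).
assert (Hwc : (w * c = RtoC (Cmod c))%C).
{ unfold w; replace (Cconj c / RtoC (Cmod c) * c)%C
    with ((c * Cconj c) / RtoC (Cmod c))%C by (field; exact Hcr).
  rewrite <- Cmod2_conj, RtoC_pow; simpl; field; exact Hcr. }
assert (Hw1 : Re w ^ 2 + Im w ^ 2 = 1).
{ rewrite <- Cmod2_alt; unfold w.
  rewrite Cmod_div, Cmod_conj, Cmod_R, Rabs_pos_eq by (exact Hcr || lra); field; lra. }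
set (N := INR m) in *.
(* [E] and [E'] are mutually inverse, and on the line Re z = s0 they are e^(iNt) and its conjugate,
   which makes the kernel in [K] real there. *)
set (E := fun z : C => Cexp (RtoC N * (z + - RtoC s0))).
set (E' := fun z : C => Cexp (- 1 * (RtoC N * (z + - RtoC s0)))).
set (K := fun z => ((F (Cexp z) + - 1) * (1 + RtoC (- / 2) * (w * E' z + Cconj w * E z)))%C).
assert (Hlin : C1_on left_half_plane (fun z => RtoC N * (z + - RtoC s0))%C).
{ apply C1_on_mult; [apply C1_on_const|].
  apply C1_on_plus; [apply C1_on_id|apply C1_on_const]. }
assert (HE : C1_on left_half_plane E).
{ apply (C1_on_comp _ (fun _ => True) Cexp (fun z => RtoC N * (z + - RtoC s0))%C); auto.
  apply C1_on_Cexp. }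
assert (HE' : C1_on left_half_plane E').
{ apply (C1_on_comp _ (fun _ => True) Cexp (fun z => - 1 * (RtoC N * (z + - RtoC s0)))%C);
    auto; [apply C1_on_Cexp|].
  apply C1_on_mult; [apply C1_on_const|exact Hlin]. }
assert (HU : forall z, left_half_plane z -> in_U (Cexp z)).
{ intros z Hz; unfold in_U; rewrite Cmod_Cexp, <- exp_0; apply exp_increasing, Hz. }
assert (HK : C1_on left_half_plane K).
{ apply C1_on_mult.
  - apply C1_on_plus; [|apply C1_on_const].
    apply (C1_on_comp _ in_U); [exact HF|apply C1_on_Cexp|exact HU].
  - apply C1_on_plus; [apply C1_on_const|].
    apply C1_on_mult; [apply C1_on_const|].
    apply C1_on_plus; (apply C1_on_mult; [apply C1_on_const|assumption]). }
(* Because m is an integer, [E] and [E'] depend on z only through e^z; this yields the period 2 pi i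
   of [K]. *)
set (b := Cexp (RtoC N * RtoC s0)).
assert (Hb0 : b <> 0%C) by apply Cexp_neq_0.
assert (Hz0 : forall z, (Cexp z ^ m)%C <> 0%C) by (intros z; apply Cpow_nz, Cexp_neq_0).
assert (EE : forall z, E z = (Cexp z ^ m / b)%C).
{ intros z; unfold E, b; rewrite <- (Cexp_pow z m); fold N.
  unfold Cdiv; rewrite <- Cexp_opp, <- Cexp_add; f_equal; ring. }
assert (EE' : forall z, E' z = (b / Cexp z ^ m)%C).
{ intros z; replace (E' z) with (/ E z)%C.
  - rewrite EE; field; split; auto.
  - unfold E, E'; rewrite <- Cexp_opp; f_equal; ring. }
assert (Hper : forall s, s < 0 -> K (s, 2 * PI) = K (s, 0)).
{ intros s _; unfold K; rewrite !EE, !EE'.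
  replace (Cexp (s, 2 * PI)) with (Cexp (s, 0)); [reflexivity|].
  unfold Cexp; simpl; now rewrite cos_2PI, sin_2PI, cos_0, sin_0. }
assert (Hb : b = RtoC (exp (N * s0))).
{ unfold b; rewrite <- RtoC_mult; unfold Cexp; simpl; rewrite cos_0, sin_0.
  apply injective_projections; simpl; ring. }
(* [K] in the variable e^zeta: the factor z^m of F - 1 cancels the pole b / z^m of the kernel, so
   [T] is continuous at 0, with value - w b c / 2 = - |c| b / 2. *)
set (T := fun z => ((z ^ m + RtoC (- / 2) * (w * b + Cconj w / b * (z ^ m * z ^ m))) * r z)%C).
assert (HT : Ccont T 0).
{ apply Ccont_mult; [|exact Hr].
  apply Ccont_plus; [apply Ccont_pow|].
  apply Ccont_mult; [apply Ccont_const|].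
  apply Ccont_plus; [apply Ccont_const|].
  apply Ccont_mult; [apply Ccont_const|].
  exact (Ccont_mult _ _ _ (Ccont_pow m 0) (Ccont_pow m 0)). }
assert (HT0 : T 0%C = RtoC (- / 2 * (Cmod c * exp (N * s0)))).
{ unfold T; rewrite Hr0; replace (0 ^ m)%C with (RtoC 0)
    by (destruct m; [lia|rewrite Cpow_S; ring]).
  rewrite !RtoC_mult, <- Hwc, <- Hb; ring. }
pose proof (RInt_vertical_le K T s0 (T 0%C) HK Hper Hs0 HT eq_refl) as Hup.
assert (Hlow : (alpha - 1) * (2 * PI) <= RInt (fun t => Re (K (s0, t))) 0 (2 * PI)).
{ pose proof (is_RInt_trig_kernel m (alpha - 1) (Re w) (Im w) Hm) as HI.
  rewrite <- (is_RInt_unique _ _ _ _ HI).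
  apply RInt_le; [lra|eexists; exact HI|now apply ex_RInt_Re_vertical|].
  intros t _; fold N.
  assert (H1 : E (s0, t) = (cos (N * t), sin (N * t))).
  { unfold E; replace (RtoC N * ((s0, t) + - RtoC s0))%C with ((0, N * t) : C)
      by (apply injective_projections; simpl; ring).
    unfold Cexp; simpl; rewrite exp_0; apply injective_projections; simpl; ring. }
  assert (H2 : E' (s0, t) = (cos (N * t), - sin (N * t))).
  { unfold E'; replace (- 1 * (RtoC N * ((s0, t) + - RtoC s0)))%C with ((0, - (N * t)) : C)
      by (apply injective_projections; simpl; ring).
    unfold Cexp; simpl; rewrite exp_0, cos_neg, sin_neg.
    apply injective_projections; simpl; ring. }
  specialize (Halpha _ (HU (s0, t) Hs0)).
  (* [kap] is the scalar product of the unit vectors [w] and e^(iNt). Hence 1 - kap is half their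
     squared distance, which gives the nonnegativity. *)
  set (kap := Re w * cos (N * t) + Im w * sin (N * t)).
  replace (Re (K (s0, t))) with ((Re (F (Cexp (s0, t))) - 1) * (1 - kap)).
  2: { unfold K; rewrite H1, H2; unfold kap.
       destruct w as [p q], (F (Cexp (s0, t))) as [x y]; unfold Re, Im; simpl; field. }
  apply Rmult_le_compat_r; [|lra].
  pose proof (sin2_cos2 (N * t)) as Hsc; unfold Rsqr in Hsc.
  unfold kap; set (C0 := cos (N * t)) in *; set (S0 := sin (N * t)) in *.
  pose proof (Rle_0_sqr (Re w - C0)); pose proof (Rle_0_sqr (Im w - S0)).
  unfold Rsqr in *; nra. }
assert (Hex : exists rho, 0 < rho /\ forall z, Cmod (Cexp z) < rho -> K z = T (Cexp z)).
{ exists rho; split; [exact Hrho|]; intros z Hz.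
  unfold K, T; rewrite EE, EE', (HFr _ Hz).
  field; split; auto. }
specialize (Hup Hex); rewrite HT0 in Hup.
unfold Re in Hup at 2; simpl fst in Hup.
set (X := Cmod c * exp (N * s0)) in *.
nra.
Qed.

(** The limit s0 -> 0 is replaced by a contradiction. If |c| > 2 (1 - alpha), put x = 2 (1 - alpha)
    / |c| and choose s0 so that e^(m s0) is the square root of x. This exceeds x as 0 < x < 1,
    whereas the previous bound says it is at most x. *)
Lemma first_coeff_bound (F : C -> C) (m : nat) (c : C) (alpha : R) :
  (1 <= m)%nat -> C1_on in_U F -> expands m 1 c F ->
  (forall z, in_U z -> alpha < Re (F z)) -> Cmod c <= 2 * (1 - alpha).
Proof.
intros Hm HF Hexp Halpha.
(* F(0) = 1 forces this; it settles the case c = 0 and makes [x] positive. *)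
assert (Ha : alpha < 1).
{ assert (H0 : in_U 0) by (unfold in_U; rewrite Cmod_0; lra).
  specialize (Halpha 0%C H0).
  destruct Hexp as [r [_ [_ [rho [Hrho E]]]]].
  rewrite E in Halpha by (rewrite Cmod_0; exact Hrho).
  replace (1 + 0 ^ m * r 0)%C with (RtoC 1) in Halpha; [exact Halpha|].
  destruct m; [lia|rewrite Cpow_S; ring]. }
destruct (Ceq_dec c 0) as [->|Hc]; [rewrite Cmod_0; lra|].
pose proof (proj1 (Cmod_gt_0 _) Hc) as Hc0.
apply Rnot_lt_le; intros Hlt.
assert (Hm0 : 0 < INR m) by (apply lt_0_INR; lia).
set (x := 2 * (1 - alpha) / Cmod c).
assert (Hx : 0 < x < 1).
{ unfold x; split; [apply Rdiv_lt_0_compat; lra|apply Rlt_div_l; lra]. }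
assert (Hln : ln x < 0) by (rewrite <- ln_1; apply ln_increasing; lra).
assert (Hs : ln x / (2 * INR m) < 0).
{ replace 0 with (0 / (2 * INR m)) by (field; lra).
  apply Rmult_lt_compat_r; [apply Rinv_0_lt_compat|]; lra. }
pose proof (first_coeff_exp_bound F m c alpha _ Hm HF Hexp Halpha Hc Hs) as H.
replace (INR m * (ln x / (2 * INR m))) with (ln x / 2) in H by (field; lra).
assert (Hxe : x < exp (ln x / 2)).
{ rewrite <- (exp_ln x) at 1 by lra; apply exp_increasing; lra. }
assert (x * Cmod c = 2 * (1 - alpha)) by (unfold x; field; lra).
nra.
Qed.

(** * The class B *)


Theorem theorem3p1 (lambda mu delta alpha : R) (f : C -> C) (a : nat -> C)
  (n : nat)
  (hlambda : 1 <= lambda) (hmu : 0 <= mu) (hdelta : 0 <= delta)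
  (halpha0 : 0 <= alpha) (halpha1 : alpha < 1)
  (hf : class_B mu alpha lambda delta f)
  (ha0 : a 0%nat = 0%C) (ha1 : a 1%nat = 1%C)
  (ha : power_series_on_U a f)
  (hn : (4 <= n)%nat)
  (hvanish : forall k : nat, (2 <= k <= n - 1)%nat -> a k = 0%C) :
  Cmod (a n) <=
    2 * (1 - alpha)
    / (mu + (INR n - 1) * lambda
       + INR n * (INR n - 1) * xi lambda mu * delta).
Proof.
destruct hf as [g [_ [[P [Q [HP [HQ HRe]]]] _]]].
(* Both f(z)/z and f'(z) start with 1, and their next possible term has degree n - 1. *)
set (m := pred n).
assert (Hm : (1 <= m)%nat) by (unfold m; lia).
assert (Hn : n = S m) by (unfold m; lia).
destruct (power_series_C_derive a f ha) as [ha' _].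
destruct (power_series_C_derive _ _ ha') as [ha'' _].
assert (hq : power_series_on_U (fun k => a (S k)) (quot f)).
{ intros z Hz; pose proof (power_series_shift a f ha z Hz) as H; cbv beta in H.
  rewrite ha0, ha1 in H; unfold quot; destruct (Ceq_dec z 0); [exact H|].
  replace (f z - 0)%C with (f z) in H by ring; exact H. }
assert (Eq : expands m 1 (a n) (quot f)).
{ pose proof (power_series_expands _ _ m hq Hm) as H; cbv beta in H.
  rewrite ha1, <- Hn in H; apply H.
  intros k Hk; apply hvanish; lia. }
assert (E1 : expands m 1 (RtoC (INR n) * a n)%C (C_derive f)).
{ pose proof (power_series_expands _ _ m ha' Hm) as H; unfold CPS_derive in H.
  rewrite ha1, <- Hn, Cmult_1_r in H; apply H.
  intros k Hk; rewrite hvanish by lia; ring. }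
(* The series of f'' has constant term 2 a_2 = 0 and leading term n (n-1) a_n z^(n-2); the factor z
   brings it to degree m. *)
assert (E2 : expands m 0 (RtoC (INR n) * RtoC (INR m) * a n)%C
    (fun z => z * C_derive (C_derive f) z)%C).
{ assert (Hm' : m = S (pred m)) by (unfold m; lia).
  rewrite Hm' at 1; apply expands_mul_id.
  pose proof (power_series_expands _ _ (pred m) ha'' ltac:(unfold m; lia)) as H.
  unfold CPS_derive in H.
  rewrite (hvanish 2%nat), <- Hm', <- Hn in H by lia.
  replace (RtoC (INR n) * RtoC (INR m) * a n)%C
    with (RtoC (INR m) * (RtoC (INR n) * a n))%C by ring.
  replace (RtoC (INR 1) * (RtoC (INR 2) * 0))%C with (RtoC 0) in H by ring.
  apply H; intros k Hk; rewrite hvanish by (unfold m in Hk; lia); ring. }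
destruct (power_branch_expands _ _ _ m _ Hm HP (power_series_C1 _ _ hq) Eq)
  as [P' [HPP' [P1 EP]]].
destruct (power_branch_expands _ _ _ m _ Hm HQ (power_series_C1 _ _ hq) Eq)
  as [Q' [HQQ' [Q1 EQ]]].
set (x := xi lambda mu) in *.
(* The coefficient of z^m is (1 - lambda) mu a_n + lambda (n + mu - 1) a_n + n (n-1) xi delta a_n,
   which is [D] times a_n; the constant term is (1 - lambda) + lambda = 1. *)
pose proof (expands_plus _ _ _ _ _ _ _
  (expands_plus _ _ _ _ _ _ _
    (expands_mult _ _ _ _ _ _ _ Hm (expands_const m (RtoC (1 - lambda))) EP)
    (expands_mult _ _ _ _ _ _ _ Hm
      (expands_mult _ _ _ _ _ _ _ Hm (expands_const m (RtoC lambda)) E1) EQ))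
  (expands_mult _ _ _ _ _ _ _ Hm (expands_const m (RtoC (x * delta))) E2)) as EF.
cbv beta in EF.
set (D := mu + (INR n - 1) * lambda + INR n * (INR n - 1) * x * delta).
assert (Hnm : INR n = INR m + 1) by (rewrite Hn; apply S_INR).
assert (Hm3 : 3 <= INR m).
{ replace 3 with (INR 3) by (simpl; ring); apply le_INR; unfold m; lia. }
assert (Hx : 0 < x).
{ unfold x, xi; apply Rdiv_lt_0_compat; lra. }
assert (HD : 0 < D).
{ assert (0 <= INR n * (INR n - 1) * x * delta).
  { apply Rmult_le_pos; [apply Rmult_le_pos; [apply Rmult_le_pos|]|]; lra. }
  assert (0 < (INR n - 1) * lambda) by (apply Rmult_lt_0_compat; lra).
  unfold D; lra. }
assert (HF : Cmod (RtoC D * a n) <= 2 * (1 - alpha)).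
{ apply first_coeff_bound with (m := m) (F := fun z => (RtoC (1 - lambda) * P' z
    + RtoC lambda * C_derive f z * Q' z
    + RtoC (x * delta) * (z * C_derive (C_derive f) z))%C); [exact Hm| | |].
  - apply C1_on_plus; [apply C1_on_plus|]; apply C1_on_mult.
    + apply C1_on_const.
    + exact P1.
    + apply C1_on_mult; [apply C1_on_const|exact (power_series_C1 _ _ ha')].
    + exact Q1.
    + apply C1_on_const.
    + apply C1_on_mult; [apply C1_on_id|exact (power_series_C1 _ _ ha'')].
  - refine (expands_eq _ _ _ _ _ _ _ _ EF).
    + rewrite RtoC_minus; ring.
    + unfold D; rewrite Hnm.
      repeat rewrite ?RtoC_plus, ?RtoC_mult, ?RtoC_minus; ring.
  - intros z Hz; specialize (HRe z Hz); rewrite (HPP' z Hz), (HQQ' z Hz) in HRe.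
    rewrite Cmult_assoc; exact HRe. }
rewrite Cmod_mult, Cmod_R, Rabs_pos_eq in HF by lra.
fold D; apply Rle_div_r; [exact HD|]; lra.
Qed.
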